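(* Let $m\geq 4$ and $0\leq r\leq m-3$. The number of small covers over $\mathrm{Bier}\,\Delta_{r}^{m-1}$ up to Davis--Januszkiewicz equivalence is $$ \begin{cases} 1+m\cdot 2^{m-2}, & \text{if } r=0 \text{ or } r=m-3,\\ 1+m, & \text{if } 0<r<m-3. \end{cases} $$
   Context: Notation: $[m]=\{1,\ldots,m\}$, and $[\overline m]=\{\overline 1,\ldots,\overline m\}$ is a disjoint copy; for $\sigma\subseteq[m]$, $\overline\sigma=\{\overline i\mid i\in\sigma\}$. Bier spheres. For a simplicial complex $K\subsetneq 2^{[m]}$, the Alexander dual is $\widehat K=\{\overline\sigma\subseteq[\overline m]\mid [m]\setminus\sigma\notin K\}$, and the Bier sphere is the deleted join $\mathrm{Bier}\,K=\{\sigma\cup\overline\tau\mid \sigma\in K,\ \overline\tau\in\widehat K,\ \sigma\cap\tau=\emptyset\}$, a simplicial complex on $[m]\cup[\overline m]$ which is an $(m-2)$-dimensional simplicial sphere. $\Delta_r^{m-1}=\{\sigma\subseteq[m]\mid |\sigma|\leq r+1\}$ is the $r$-skeleton of the $(m-1)$-simplex on $[m]$. It is known that $\mathrm{Bier}\,\Delta_r^{m-1}$ is polytopal, i.e. it is the dual complex of a simple polytope. Small covers. Let $\Gamma$ be an $(n-1)$-dimensional polytopal simplicial sphere with finite vertex set $S$. A (mod 2) characteristic matrix over $\Gamma$ is an $n\times|S|$ matrix $\Lambda$ over $\mathbb{Z}_2=\mathbb{Z}/2$, with columns indexed by $S$, such that for every simplex of $\Gamma$ the columns indexed by its vertices are linearly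 independent (non-singularity condition); it is regarded as a linear map $\lambda:\mathbb{Z}_2^{S}\to\mathbb{Z}_2^n$. With $D^1=[-1,1]$ and $S^0=\{-1,1\}$, the real moment-angle complex is $\mathbb{R}\mathcal{Z}_\Gamma=\bigcup_{\sigma\in\Gamma}\{x\in(D^1)^{S}\mid x_i\in S^0 \text{ for } i\notin\sigma\}$, on which $\mathbb{Z}_2^{S}$ acts by coordinatewise sign changes. The small cover over $\Gamma$ associated with $\Lambda$ is $M(\Gamma,\Lambda)=\mathbb{R}\mathcal{Z}_\Gamma/\ker\lambda$ (the action of $\ker\lambda$ is free). Two characteristic matrices $\Lambda_1,\Lambda_2$ over $\Gamma$, and the corresponding small covers, are Davis--Januszkiewicz (D--J) equivalent if $\Lambda_2=P\Lambda_1$ for some $P\in \mathrm{GL}(n,\mathbb{Z}_2)$. For $\Gamma=\mathrm{Bier}\,\Delta_r^{m-1}$ one has $n=m-1$ and $S=[m]\cup[\overline m]$. *)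

(* Defs.v *)
From HB Require Import structures.
From mathcomp Require Import all_boot all_order all_algebra.
From mathcomp Require Import all_classical all_reals topology.
Import Order.TTheory GRing.Theory Num.Theory numFieldTopology.Exports.

Set Implicit Arguments.
Unset Strict Implicit.
Unset Printing Implicit Defensive.

Local Open Scope ring_scope.

(* The vertex set [m] is 'I_m, and its disjoint union with the copy [\bar m]
   is 'I_m + 'I_m.  A subset of [\bar m] is stored as the subset of 'I_m that
   it copies; the bars are put back by [inr] in [bier]. *)

Definition alexander_dual (m : nat) (K : {set {set 'I_m}}) :
    {set {set 'I_m}} :=
  [set tau | ~: tau \notin K].

Definition bier (m : nat) (K : {set {set 'I_m}}) :
    {set {set 'I_m + 'I_m}} :=
  [set (inl @: sigma) :|: (inr @: tau) |
    sigma : {set 'I_m} in K, tau : {set 'I_m} in alexander_dual K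
    & [disjoint sigma & tau]].

Definition skeleton (m r : nat) : {set {set 'I_m}} :=
  [set sigma : {set 'I_m} | (#|sigma| <= r.+1)%N].

Section SmallCovers.
Variables (n : nat) (S : finType).
Implicit Types (G : {set {set S}}) (L : 'M['F_2]_(n, #|S|)).

(* [free] on the sequence of columns also forces them to be pairwise distinct. *)
Definition characteristic G L : bool :=
  [forall sigma in G, free [seq col (enum_rank s) L | s <- enum sigma]].

(* A small cover over G comes with the characteristic matrix it is associated
   with; M(G, L) itself is [small_cover_space] below.  The intended n
   is dim G + 1. *)
Record small_cover G := SmallCover {
  char_matrix : 'M['F_2]_(n, #|S|);
  char_matrixP : characteristic G char_matrix }.

HB.instance Definition _ G := [isSub for @char_matrix G].
HB.instance Definition _ G := [Finite of small_cover G by <:].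

Definition DJ_equiv G (M1 M2 : small_cover G) : bool :=
  [exists P : 'M['F_2]_n,
    (P \in unitmx) && (char_matrix M2 == P *m char_matrix M1)].

Lemma DJ_equiv_refl G : reflexive (@DJ_equiv G).
Proof.
by move=> M; apply/existsP; exists 1%:M; rewrite unitmx1 mul1mx eqxx.
Qed.

Lemma DJ_equiv_sym G : symmetric (@DJ_equiv G).
Proof.
suff sub M1 M2 : @DJ_equiv G M1 M2 -> DJ_equiv M2 M1.
  by move=> M1 M2; apply/idP/idP; exact: sub.
move=> /existsP[P /andP[uP /eqP e]]; apply/existsP; exists (invmx P).
by rewrite unitmx_inv uP e mulmxA mulVmx// mul1mx eqxx.
Qed.

Lemma DJ_equiv_trans G : transitive (@DJ_equiv G).
Proof.
move=> M2 M1 M3 /existsP[P /andP[uP /eqP e2]] /existsP[Q /andP[uQ /eqP e3]].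
by apply/existsP; exists (Q *m P); rewrite unitmx_mul uQ uP e3 e2 mulmxA eqxx.
Qed.

Definition DJ_classes G : {set {set small_cover G}} :=
  equivalence_partition (@DJ_equiv G) [set: small_cover G].

Section Space.
Variable R : realType.
Local Open Scope classical_set_scope.

Definition real_moment_angle G : set (prod_topology (fun _ : S => R)) :=
  [set x | exists2 sigma, sigma \in G &
     (forall i, x i \in `[-1, 1]) /\
     (forall i, i \notin sigma -> x i = -1 \/ x i = 1)].

(* The exponent is the entry of g in {0, 1}, coerced from 'F_2 to nat. *)
Definition sign_change (g : 'cV['F_2]_#|S|) (x : S -> R) : S -> R :=
  fun i => (-1) ^+ (g (enum_rank i) 0) * x i.

Lemma sign_change0 x : sign_change 0 x = x.
Proof. by apply/funext => i; rewrite /sign_change mxE mul1r. Qed.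

Lemma sign_changeD g h x :
  sign_change (g + h) x = sign_change g (sign_change h x).
Proof.
apply/funext => i; rewrite /sign_change mxE mulrA -exprD; congr (_ * _).
by rewrite -signr_odd -[RHS]signr_odd oddD; congr (_ ^+ nat_of_bool _);
   case: (g _ _) => -[|[|//]] ?; case: (h _ _) => -[|[|//]] ?.
Qed.

Variables (G : {set {set S}}) (M : small_cover G).

Definition kernel_orbit_rel (x y : real_moment_angle G) : bool :=
  [exists g : 'cV['F_2]_#|S|,
    (char_matrix M *m g == 0) && (set_val y == sign_change g (set_val x))].

Lemma kernel_orbit_equiv : equiv_class_of kernel_orbit_rel.
Proof.
have sub x y : kernel_orbit_rel x y -> kernel_orbit_rel y x.
  move=> /existsP[g /andP[/eqP kg /eqP e]]; apply/existsP; exists (- g).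
  by rewrite mulmxN kg oppr0 eqxx e -sign_changeD addNr sign_change0 eqxx.
split=> [x|x y|y x z].
- by apply/existsP; exists 0; rewrite mulmx0 sign_change0 !eqxx.
- by apply/idP/idP; exact: sub.
- move=> /existsP[g /andP[/eqP kg /eqP ey]] /existsP[h /andP[/eqP kh /eqP ez]].
  by apply/existsP; exists (h + g);
    rewrite mulmxDr kg kh addr0 ez ey sign_changeD !eqxx.
Qed.

Canonical kernel_orbit_equivRel := EquivRelPack kernel_orbit_equiv.

Definition small_cover_space : topologicalType :=
  @quotient_topology (real_moment_angle G)
    {eq_quot kernel_orbit_equivRel}%qT.

End Space.
End SmallCovers.

(* Main.v *)
Require Import Defs.
From mathcomp Require Import all_boot all_order all_algebra.
From mathcomp Require Import boolp zify.
Import GRing.Theory.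

(** Write x_i and y_i for the columns of a characteristic matrix indexed by i
and by its copy, and put a = r + 1, b = m - r - 2, so that a + b = m - 1.  The
facets of the Bier sphere are the pairs of disjoint sets (S, T) of sizes a and
b, and over F_2 a family is free exactly when no nonempty subfamily sums to 0.
A characteristic matrix is therefore a pair of families x, y in F_2^(m-1) such
that no nonempty pair of disjoint sets S, T with |S| <= a and |T| <= b
satisfies x(S) + y(T) = 0, where x(S) denotes the sum of the x_i for i in S.
Exchanging x and y exchanges a and b, so b >= 2 can be assumed.

Up to a linear automorphism there are few such pairs.  Either x = y and the m
vectors y_i have total sum 0, which gives one class, or there is an index k with
x_i = y_i + y_k for i != k and y([m]) = a y_k; then x_k = y_k if a >= 2, which
gives m classes, while for a = 1 the vector x_k - y_k is arbitrary in the
hyperplane spanned by the y_i with i != k, which gives m * 2^(m-2) classes.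

For a = 1 this is elementary: any b of the y_i are independent, so exactly one
nonempty set U has y(U) = 0 and it misses at most one index k; writing a
relation between x_i and the y_j with j != i then expresses x_i
([classification1]).  For a >= 2 one argues by induction, dividing by a vector
x_p: this is the link of the vertex p, and it yields a configuration of type
(a - 1, b) on the other indices.  The types found in the links of different
vertices constrain each other enough to determine the type of the whole
configuration ([gluing], [classification]).

To count, each type is parametrised linearly by families w of total sum 0
([normal_x], [normal_y]).  Since all such families are images of one circuit of
m vectors in F_2^(m-1), every type is a single orbit of GL; it is represented by
an explicit characteristic matrix ([normal_nonsingular]), and different types
are not equivalent ([normal_inj]).  Counting the types gives the theorem. *)

Set Implicit Arguments.
Unset Strict Implicit.
Unset Printing Implicit Defensive.

Local Open Scope ring_scope.

(** * Subset sums over the field with two elements *)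

Section CharTwo.
Variable n : nat.
Implicit Types u v : 'rV['F_2]_n.

Lemma addvv u : u + u = 0.
Proof. by apply/rowP=> i; rewrite !mxE; apply: (addrr_pchar2 (pchar_Fp _)). Qed.

Lemma oppv u : - u = u.
Proof. exact: addr0_eq (addvv u). Qed.

Lemma addv_eq0 u v : u + v = 0 -> u = v.
Proof. by move/eqP; rewrite addr_eq0 oppv => /eqP. Qed.

Lemma addvK u v : u + v + v = u.
Proof. by rewrite -addrA addvv addr0. Qed.

Lemma mulrn_odd u k : u *+ k = u *+ odd k.
Proof.
by rewrite -{1}(odd_double_half k) mulrnDr -mul2n mulrnA mulr2n addvv mul0rn
   addr0.
Qed.

Section SubsetSums.
Variable I : finType.
Implicit Types (S T U J Q : {set I}) (x y z : I -> 'rV['F_2]_n).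

Definition symdiff S T := (S :\: T) :|: (T :\: S).

Lemma in_symdiff S T i : (i \in symdiff S T) = (i \in S) (+) (i \in T).
Proof. by rewrite !inE; case: (i \in S); case: (i \in T). Qed.

Lemma symdiff_eq0 S T : symdiff S T = set0 -> S = T.
Proof.
move=> e; apply/setP=> i; have := in_set0 i.
by rewrite -e in_symdiff; case: (i \in S); case: (i \in T).
Qed.

Lemma sum_mem S z : \sum_(i in S) z i = \sum_i z i *+ (i \in S).
Proof. by rewrite big_mkcond; apply: eq_bigr => i _; case: (i \in S). Qed.

Lemma sum_symdiff S T z :
  \sum_(i in symdiff S T) z i = \sum_(i in S) z i + \sum_(i in T) z i.
Proof.
rewrite !sum_mem -big_split; apply: eq_bigr => i _ /=.
rewrite in_symdiff; case: (i \in S); case: (i \in T);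
  by rewrite ?mulr1n ?mulr0n ?addvv ?addr0 ?add0r.
Qed.

(** Pigeonhole: two of the 2^|J| subset sums coincide, and the symmetric
difference of the two subsets has sum 0. *)
Lemma exists_zero_sum J z : (n < #|J|)%N ->
  exists S, [/\ S \subset J, S != set0 & \sum_(i in S) z i = 0].
Proof.
move=> nJ; have : ~~ dinjectiveb (fun S => \sum_(i in S) z i) (powerset J).
  apply/negP=> /dinjectiveP /card_in_image => e.
  have := max_card [in image (fun S => \sum_(i in S) z i) (powerset J)].
  by rewrite e card_powerset card_mx card_Fp // mul1n leq_exp2l // leqNgt nJ.
case/dinjectivePn=> S; rewrite inE => SJ [T /andP[TS TJ] e].
move: TS TJ; rewrite inE => TS TJ.
exists (symdiff S T); split; last by rewrite sum_symdiff e addvv.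
  by apply/subsetP=> i; rewrite in_symdiff; move/subsetP: SJ => /(_ i);
     move/subsetP: TJ => /(_ i); case: (i \in S); case: (i \in T) => //= h1 h2 _;
     auto.
by apply: contra_not_neq (elimN eqP TS) => /symdiff_eq0.
Qed.

(** The index set J is a parameter because links of vertices, which are
configurations on fewer indices, are used in the classification. *)
Definition nonsingular J a b x y := forall S T,
  S \subset J -> T \subset J -> [disjoint S & T] ->
  (#|S| <= a)%N -> (#|T| <= b)%N ->
  \sum_(i in S) x i + \sum_(i in T) y i = 0 -> S = set0 /\ T = set0.

(** This replaces the bound |J| - 1 on the dimension of the ambient space: it
is inherited by the image of the configuration in a quotient, even when that
quotient is realised inside a space of the original dimension. *)
Definition dependent J x y := forall Q, Q \subset J ->
  exists S T, [/\ S \subset Q, T \subset J :\: Q, (S != set0) || (T != set0)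
    & \sum_(i in S) x i + \sum_(i in T) y i = 0].

Lemma dependent_of_card J x y : (n < #|J|)%N -> dependent J x y.
Proof.
move=> nJ Q QJ.
have [S [SJ S0]] := exists_zero_sum (fun i => if i \in Q then x i else y i) nJ.
rewrite (big_setID Q) /= => e.
exists (S :&: Q), (S :\: Q); split.
- exact: subsetIr.
- exact: setSD.
- by rewrite -negb_and -setU_eq0 setID.
rewrite -[RHS]e; congr (_ + _); apply: eq_bigr => i; rewrite inE.
  by case/andP=> _ ->.
by case/andP=> /negbTE->.
Qed.

(** The form of [nonsingular] suited to relations with few explicit terms. *)
Lemma nonsingular_seq J a b x y (s t : seq I) : nonsingular J a b x y ->
  uniq (s ++ t) -> {subset s ++ t <= J} -> (size s <= a)%N -> (size t <= b)%N ->
  \sum_(i <- s) x i + \sum_(i <- t) y i = 0 -> s ++ t = [::].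
Proof.
move=> H; rewrite cat_uniq => /and3P[us st ut] stJ sa tb e.
have [||||||] := H [set i in s] [set i in t].
- by apply/subsetP=> i; rewrite inE => i_s; apply: stJ; rewrite mem_cat i_s.
- by apply/subsetP=> i; rewrite inE => i_s; apply: stJ; rewrite mem_cat i_s orbT.
- rewrite disjoint_sym disjoint_subset; apply/subsetP=> i; rewrite !inE => it.
  by apply: contra st => i_s; apply/hasP; exists i.
- by rewrite cardsE (card_uniqP us).
- by rewrite cardsE (card_uniqP ut).
- by under eq_bigl do rewrite inE; under [X in _ + X]eq_bigl do rewrite inE;
     rewrite -!big_uniq.
case: s {us st sa stJ e} => [_|i s /setP/(_ i)]; last by rewrite !inE eqxx.
by case: t {ut tb} => // i t /setP/(_ i); rewrite !inE eqxx.
Qed.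

Lemma nonsingular_swap J a b x y :
  nonsingular J a b x y -> nonsingular J b a y x.
Proof.
move=> H S T SJ TJ ST Sb Ta; rewrite addrC disjoint_sym in ST * => e.
by have [-> ->] := H T S TJ SJ ST Ta Sb e.
Qed.

Definition type0 J x y :=
  (forall i, i \in J -> x i = y i) /\ \sum_(i in J) y i = 0.

(** The sum over J includes y k itself: the vectors y i with i != k add up
to a.+1 times y k. *)
Definition typek J a x y k := [/\ k \in J,
  forall i, i \in J -> i != k -> x i = y i + y k
  & \sum_(i in J) y i = y k *+ a].

(** Two zero sums y(U) = y(T) = 0 with U and T nonempty have |U|, |T| > b, so U
and T differ in at most two elements, which is too few for the symmetric
difference to have sum 0; hence T is unique.  A relation between x i and the
y j with j != i that involves no x i would be this T, and one that omits some
y j would be too short; hence x i = y(J - i) unless T = J - i. *)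
Lemma classification1 J b x y : (2 <= b)%N -> #|J| = b.+2 ->
  nonsingular J 1 b x y -> dependent J x y ->
  type0 J x y \/ exists k, typek J 1 x y k.
Proof.
move=> b2 cJ ns dep.
have big U : U \subset J -> \sum_(i in U) y i = 0 -> U != set0 -> (b < #|U|)%N.
  move=> UJ U0; rewrite ltnNge; apply: contra => Ub; apply/eqP.
  have [||||||_ ->] := ns set0 U; rewrite ?sub0set ?cards0 ?big_set0 ?add0r //.
  by rewrite -setI_eq0 set0I.
have [S [T [S0 TJ ne e]]] := dep set0 (sub0set J).
move: S0 ne e; rewrite subset0 => /eqP->; rewrite eqxx big_set0 add0r /= => T0 yT.
rewrite setD0 in TJ; have cT := big T TJ yT T0.
have uniqT U : U \subset J -> \sum_(i in U) y i = 0 -> U != set0 -> U = T.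
  move=> UJ yU U0; have cU := big U UJ yU U0.
  apply: symdiff_eq0; apply/eqP/negPn/negP => /(big _ _ _).
  have sub : symdiff U T \subset (J :\: T) :|: (J :\: U).
    exact: setUSS (setSD _ UJ) (setSD _ TJ).
  rewrite (subset_trans sub) ?subUset ?subsetDl // sum_symdiff yU yT addr0.
  move=> /(_ isT erefl); have := subset_leq_card sub.
  have := (leq_card_setU (J :\: T) (J :\: U)).1.
  rewrite !cardsD (setIidPr TJ) (setIidPr UJ) cJ; lia.
have yJ i : i \in J -> \sum_(j in J :\ i) y j = y i + \sum_(j in J) y j.
  by move=> iJ; rewrite [in RHS](big_setD1 i) //= addrA addvv add0r.
have xE i : i \in J -> T != J :\ i -> x i = y i + \sum_(j in J) y j.
  move=> iJ Ti; have cJi : #|J :\ i| = b.+1 by move: cJ; rewrite (cardsD1 i J) iJ; lia.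
  have [|S1 [T1 [S1i T1J ne e]]] := dep [set i]; first by rewrite sub1set.
  move: S1i; rewrite subset1 => /orP[]/eqP ES; move: ne e; rewrite ES; last first.
    rewrite big_set0 add0r eqxx /= => T1_0 yT1; case/eqP: Ti.
    rewrite -(uniqT T1) ?(subset_trans T1J) ?subsetDl //.
    apply/eqP; rewrite eqEcard T1J cJi; apply: big => //.
    by rewrite (subset_trans T1J) ?subsetDl.
  rewrite big_set1 => _ e; rewrite -yJ //; suff <- : T1 = J :\ i by apply: addv_eq0.
  apply/eqP; rewrite eqEcard T1J cJi ltnNge; apply/negP=> cT1.
  have [||||||/setP/(_ i)] // := ns [set i] T1.
  - by rewrite sub1set.
  - by rewrite (subset_trans T1J) ?subsetDl.
  - rewrite disjoints1; apply/negP=> iT1.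
    by move/subsetP: T1J => /(_ i iT1); rewrite !inE eqxx.
  - by rewrite cards1.
  - by rewrite big_set1.
  - by rewrite !inE eqxx.
have [TE|TnJ] := eqVneq T J.
  left; rewrite TE in yT; split=> // i iJ; rewrite xE ?yT ?addr0 //.
  by rewrite TE; apply/eqP=> /setP/(_ i); rewrite !inE eqxx iJ.
right; have /subsetPn[k kJ kT] : ~~ (J \subset T).
  by apply: contra TnJ => JT; rewrite eqEsubset TJ.
have TE : T = J :\ k.
  apply/eqP; rewrite eqEcard subsetD1 TJ kT /=.
  by move: cJ; rewrite (cardsD1 k J) kJ; lia.
have yJk : \sum_(i in J) y i = y k by rewrite (big_setD1 k) //= -TE yT addr0.
exists k; split=> // i iJ ik; rewrite xE ?yJk //.
by rewrite TE; apply/eqP=> /setP/(_ i); rewrite !inE eqxx iJ ik.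
Qed.

End SubsetSums.
End CharTwo.

(** * Gluing the links of the vertices *)

Section Gluing.
Variables (n : nat) (I : finType) (J : {set I}) (a b : nat).
Variables x y : I -> 'rV['F_2]_n.
Hypotheses (a2 : (2 <= a)%N) (b2 : (2 <= b)%N) (cJ : (5 <= #|J|)%N).
Hypothesis ns : nonsingular J a b x y.

(** Vanishing in the quotient by x p. *)
Definition modx p (v : 'rV['F_2]_n) := v = 0 \/ v = x p.

(** [link0 p] and [linkk p k] say that the link of p, on the indices other than
p and with a - 1 in place of a, has the first type, respectively the type with
centre k. *)
Definition link0 p :=
  (forall i, i \in J -> i != p -> modx p (x i + y i)) /\
  modx p (\sum_(i in J :\ p) y i).

Definition linkk p k := [/\ k \in J, k != p,
  forall i, i \in J -> i != p -> i != k -> modx p (x i + y i + y k)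
  & modx p (\sum_(i in J :\ p) y i + y k *+ a.-1)].

Lemma fresh (s : seq I) : (size s < #|J|)%N -> exists2 i, i \in J & i \notin s.
Proof.
move=> sJ; suff /subsetPn[i iJ i_s] : ~~ (J \subset s) by exists i.
by apply/negP=> /subset_leq_card/leq_trans/(_ (card_size s)); rewrite leqNgt sJ.
Qed.

(** A sum of one or two y's is never in the span of x p and x p', unless an
index is repeated. *)
Lemma span_out p p' u u' (t : seq I) : p \in J -> p' \in J -> modx p u ->
  modx p' u' -> uniq t -> {subset t <= J} -> (0 < size t <= 2)%N ->
  p \notin t -> p' \notin t -> \sum_(i <- t) y i = u + u' -> False.
Proof.
move=> pJ p'J mu mu' ut tJ /andP[t0 t2] pt p't e.
have [s [us ss sp E]] : exists s : seq I, [/\ uniq s, (size s <= 2)%N,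
    {subset s <= [:: p; p']} & \sum_(i <- s) x i = u + u'].
  case: mu mu' => [-> | ->] [-> | ->].
  - by exists [::]; rewrite big_nil addr0.
  - exists [:: p']; rewrite big_seq1 add0r; split=> // i.
    by rewrite !inE => ->; rewrite orbT.
  - exists [:: p]; rewrite big_seq1 addr0; split=> // i.
    by rewrite !inE => ->.
  have [<-|pp'] := eqVneq p p'; first by exists [::]; rewrite big_nil addvv.
  by exists [:: p; p']; rewrite big_cons big_seq1; split=> //=; rewrite inE pp'.
suff : s ++ t = [::] by move: t0; case: (s) => //; case: (t).
apply: (nonsingular_seq ns); rewrite ?(leq_trans ss) ?(leq_trans t2) //.
- rewrite cat_uniq us ut andbT; apply/hasPn=> i it; apply: contraL it => /sp.
  by rewrite !inE => /orP[]/eqP->.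
- by move=> i; rewrite mem_cat => /orP[/sp|/tJ //];
     rewrite !inE => /orP[]/eqP->.
- by rewrite e E addvv.
Qed.

Lemma y_neq0 k : k \in J -> y k != 0.
Proof.
move=> kJ; apply/eqP=> yk; suff : [::] ++ [:: k] = [::] by [].
apply: (nonsingular_seq ns) => //=; first by move=> i; rewrite inE => /eqP->.
  by rewrite (leq_trans _ b2).
by rewrite big_nil big_seq1 add0r.
Qed.

Lemma modx_meet p p' v : p \in J -> p' \in J -> p != p' -> modx p v ->
  modx p' v -> v = 0.
Proof.
move=> pJ p'J pp' [-> //|->] [//|e]; suff : [:: p; p'] ++ [::] = [::] by [].
apply: (nonsingular_seq ns) => //=; first by rewrite inE pp'.
  by move=> i; rewrite !inE => /orP[]/eqP->.
by rewrite big_nil big_cons big_seq1 addr0 e addvv.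
Qed.

(** For an index i away from p, p' and k, the vector x i + y i is 0 modulo
x p' and y k modulo x p, which puts y k in the span of x p and x p'. *)
Lemma link0_linkk p p' k : p \in J -> p' \in J -> link0 p' -> linkk p k ->
  k = p'.
Proof.
move=> pJ p'J [N0 _] [kJ kp E _]; apply/eqP/negPn/negP=> kp'.
have [i iJ] := @fresh [:: p; k; p'] (ltnW cJ).
rewrite !inE !negb_or => /and3P[ip ik ip'].
apply: (@span_out p p' _ _ [:: k] pJ p'J (E i iJ ip ik) (N0 i iJ ip')) => //.
- by move=> j; rewrite inE => /eqP->.
- by rewrite inE eq_sym.
- by rewrite inE eq_sym.
by rewrite big_seq1 addrAC addvv add0r.
Qed.

(** As in [link0_linkk], the vector x i + y i puts y k + y k' in the span of
x p and x p'.  The two exceptions are the cases where [span_out] does not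
apply. *)
Lemma linkk_linkk p p' k k' : p \in J -> p' \in J -> p != p' ->
  linkk p k -> linkk p' k' -> [\/ k = k', k = p' | k' = p].
Proof.
move=> pJ p'J pp' [kJ kp E _] [k'J k'p' E' _].
have [|kk'] := eqVneq k k'; first by constructor 1.
have [|kp'] := eqVneq k p'; first by constructor 2.
have [|k'p] := eqVneq k' p; first by constructor 3.
exfalso; have [i iJ] := @fresh [:: p; k; p'; k'] cJ.
rewrite !inE !negb_or => /and4P[ip ik ip' ik'].
apply: (@span_out p p' _ _ [:: k; k'] pJ p'J (E i iJ ip ik) (E' i iJ ip' ik')).
- by rewrite /= inE kk'.
- by move=> j; rewrite !inE => /orP[]/eqP->.
- by [].
- by rewrite !inE negb_or eq_sym kp eq_sym.
- by rewrite !inE negb_or ![p' == _]eq_sym kp' k'p'.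
by rewrite big_cons big_seq1 addrACA addvv add0r.
Qed.

Hypothesis links : forall p, p \in J -> link0 p \/ exists k, linkk p k.

(** If k is the centre for p while p' has another centre, then by [linkk_linkk]
the centre for p' must be p, and then p is the centre for all vertices other
than p. *)
Lemma link_center : (forall p, p \in J -> link0 p) \/
  exists2 k, k \in J & forall p, p \in J -> p != k -> linkk p k.
Proof.
have [[p [k [pJ Epk]]]|nE] := EM (exists p k, p \in J /\ linkk p k); last first.
  left=> p pJ; have [//|[k Epk]] := links pJ.
  by case: nE; exists p, k.
right; have [kJ kp _ _] := Epk.
have [all_k|] := EM (forall p', p' \in J -> p' != k -> linkk p' k).
  by exists k.
move=> /existsNP[p' /not_implyP[p'J /not_implyP[p'k nEp'k]]].
have pp' : p != p' by apply: contra_not_neq nEp'k => <-.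
have Ep'p : linkk p' p.
  have [N|[k' Ek']] := links p'J.
    by rewrite (link0_linkk pJ p'J N Epk) eqxx in p'k.
  have [e|e|<- //] := linkk_linkk pJ p'J pp' Epk Ek'.
    by rewrite -e in Ek'.
  by rewrite e eqxx in p'k.
have Eq q : q \in J -> q != k -> q != p -> linkk q p.
  move=> qJ qk qp; have [-> //|qp'] := eqVneq q p'.
  have [N|[c Ec]] := links qJ.
    by rewrite (link0_linkk pJ qJ N Epk) eqxx in qk.
  have [e|e|e] := linkk_linkk qJ pJ qp Ec Epk; last 2 first.
  - by rewrite e in Ec.
  - by rewrite e eqxx in qk.
  have [e'|e'|e'] := linkk_linkk qJ p'J qp' Ec Ep'p.
  - by rewrite e' in Ec.
  - by rewrite -e e' eqxx in p'k.
  - by rewrite e' eqxx in qp.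
exists p => // q qJ qp; have [qk|qk] := eqVneq q k; last exact: Eq.
rewrite {q}qk in qJ qp *.
have [N|[c Ec]] := links kJ.
  by rewrite (link0_linkk p'J kJ N Ep'p) eqxx in kp.
have kp' : k != p' by rewrite eq_sym.
have [e|e|e] := linkk_linkk kJ p'J kp' Ec Ep'p.
- by rewrite e in Ec.
- have [q qJ'] := @fresh [:: p; p'; k] (ltnW cJ).
  rewrite !inE !negb_or => /and3P[qp'' qp' qk].
  have kq : k != q by rewrite eq_sym.
  have [e'|e'|e'] := linkk_linkk kJ qJ' kq Ec (Eq q qJ' qk qp'').
  + by rewrite -e e' eqxx in pp'.
  + by rewrite -e e' eqxx in qp'.
  + by rewrite e' eqxx in kp.
- by rewrite e eqxx in kp.
Qed.

(** A relation that holds modulo x p for two different p holds exactly; in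
[link_center] all relations but the one on x k hold modulo x p for at least two
p.  For x k = y k, look at the link of k itself: it either gives the equation
directly, or has a centre q with x k = y k + y q, and then x k + x q = 0 is a
forbidden relation. *)
Lemma gluing : type0 J x y \/ exists k, typek J a x y k /\ x k = y k.
Proof.
have two i j v : (forall p, p \in J -> p != i -> p != j -> modx p v) -> v = 0.
  move=> H; have [p pJ] := @fresh [:: i; j] (ltnW (ltnW cJ)).
  rewrite !inE negb_or => /andP[pi pj].
  have [q qJ] := @fresh [:: i; j; p] (ltnW cJ).
  rewrite !inE !negb_or => /and3P[qi qj qp].
  by apply: (modx_meet qJ pJ qp); apply: H.
have [N|[k kJ E]] := link_center.
  left; have xy i : i \in J -> x i = y i.
    move=> iJ; apply: addv_eq0; apply: (two i i) => p pJ pi _.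
    by have [N0 _] := N p pJ; apply: N0; rewrite // eq_sym.
  split=> //; have [k kJ] := @fresh [::] (ltnW (ltnW (ltnW (ltnW cJ)))).
  move=> _; apply: (two k k) => p pJ _ _; have [_] := N p pJ.
  rewrite (big_setD1 p pJ) /= => -[->|->].
    by right; rewrite addr0 xy.
  by left; rewrite xy // addvv.
right; exists k.
have xE i : i \in J -> i != k -> x i = y i + y k.
  move=> iJ ik; apply: addv_eq0; rewrite addrA; apply: (two i k) => p pJ pi pk.
  by have [_ _ H _] := E p pJ pk; apply: H; rewrite // eq_sym.
split.
  split=> //; apply: addv_eq0; apply: (two k k) => p pJ pk _.
  have [_ _ _] := E p pJ pk; rewrite (big_setD1 p pJ) /= /modx xE //.
  have -> : y k *+ a = y k + y k *+ a.-1 by rewrite -mulrS prednK // ltnW.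
  rewrite addrACA => -[->|->].
    by right; rewrite addr0.
  by left; rewrite addvv.
have [i iJ] := @fresh [:: k] (ltnW (ltnW (ltnW cJ))).
rewrite inE => ik.
have [[N _]|[q [qJ qk Eq _]]] := links kJ.
  have := N i iJ ik; rewrite xE // addrAC addvv add0r => -[/eqP|//].
  by rewrite (negbTE (y_neq0 kJ)).
have [j jJ] := @fresh [:: k; q] (ltnW (ltnW cJ)).
rewrite !inE negb_or => /andP[jk jq].
have := Eq j jJ jk jq; rewrite xE // (addrAC (y j)) addvv add0r => H.
have [e|e] := H.
  exfalso; apply: (@span_out j j 0 0 [:: k; q]) => //; try by left.
  - by rewrite /= inE eq_sym qk.
  - by move=> l; rewrite !inE => /orP[]/eqP->.
  - by rewrite !inE negb_or jk.
  - by rewrite !inE negb_or jk.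
  by rewrite big_cons big_seq1 e addr0.
suff : [:: k; q] ++ [::] = [::] by [].
apply: (nonsingular_seq ns) => //=; first by rewrite inE eq_sym qk.
  by move=> l; rewrite !inE => /orP[]/eqP->.
by rewrite big_nil big_cons big_seq1 addr0 -e xE // (addrC (y q)) addvv.
Qed.

End Gluing.

(** * Classification by induction on links *)

Section Classification.
Variables (n : nat) (I : finType) (b : nat).
Implicit Types (J : {set I}) (x y : I -> 'rV['F_2]_n).

(** Multiplication by [cokermx v] realises the quotient by v. *)
Lemma mul_cokermx_eq0 (u v : 'rV['F_2]_n) :
  u *m cokermx v = 0 -> u = 0 \/ u = v.
Proof.
move/eqP; rewrite -submxE => /sub_rVP[c ->].
case: c => -[|[|//]] ic; [left|right].
  by rewrite (_ : Ordinal ic = 0) ?scale0r //; apply: val_inj.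
by rewrite (_ : Ordinal ic = 1) ?scale1r //; apply: val_inj.
Qed.

Lemma sum_quotient q (S T : {set I}) x y (C : 'M_(n, q)) :
  \sum_(i in S) x i *m C + \sum_(i in T) y i *m C =
  (\sum_(i in S) x i + \sum_(i in T) y i) *m C.
Proof. by rewrite mulmxDl !mulmx_suml. Qed.

Lemma nonsingular_link J a x y p : p \in J -> nonsingular J a.+1 b x y ->
  nonsingular (J :\ p) a b (fun i => x i *m cokermx (x p))
    (fun i => y i *m cokermx (x p)).
Proof.
move=> pJ ns S T; rewrite !subsetD1 => /andP[SJ pS] /andP[TJ pT] ST Sa Tb.
rewrite sum_quotient => /mul_cokermx_eq0[|e]; first by apply: ns => //; exact: leqW.
have [||||||/setP/(_ p)] := ns (p |: S) T; rewrite ?inE ?eqxx //.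
- by rewrite subUset sub1set pJ.
- by rewrite -setI_eq0 setIUl setU_eq0 !setI_eq0 disjoints1 pT.
- by rewrite cardsU1 pS.
by rewrite big_setU1 //= -addrA e addvv.
Qed.

(** Dropping x p from a relation leaves a nonempty relation in the link, since
the relation is not x p = 0. *)
Lemma dependent_link J a x y p : p \in J -> nonsingular J a.+1 b x y ->
  dependent J x y ->
  dependent (J :\ p) (fun i => x i *m cokermx (x p))
    (fun i => y i *m cokermx (x p)).
Proof.
move=> pJ ns dep Q; rewrite subsetD1 => /andP[QJ pQ].
have [|S [T [SQ TQ ne e]]] := dep (p |: Q); first by rewrite subUset sub1set pJ.
exists (S :\ p), T; split.
- by rewrite subDset.
- by rewrite setDDl.
- rewrite -negb_and; apply/negP=> /andP[]; rewrite setD_eq0 subset1.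
  case/orP=> /eqP ES /eqP T0; move: ne e; rewrite ES T0 ?eqxx // big_set1 => _ e.
  have [||||||/setP/(_ p)] := ns [set p] set0; rewrite ?sub0set ?sub1set //.
  + by rewrite -setI_eq0 setI0.
  + by rewrite cards1.
  + by rewrite cards0.
  + by rewrite big_set1.
  by rewrite !inE eqxx.
rewrite sum_quotient; have [pS|pS] := boolP (p \in S).
  have -> : \sum_(i in S :\ p) x i + \sum_(i in T) y i = x p.
    by apply: addv_eq0; rewrite addrC addrA -big_setD1.
  exact: mulmx_coker.
have -> : S :\ p = S by apply/setDidPl; rewrite disjoint_sym disjoints1.
by rewrite e mul0mx.
Qed.

Theorem classification a J x y : (0 < a)%N -> (2 <= b)%N ->
  #|J| = (a + b).+1 -> nonsingular J a b x y -> dependent J x y ->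
  type0 J x y \/ exists k, typek J a x y k /\ ((2 <= a)%N -> x k = y k).
Proof.
case: a => // a _ b2; elim: a J x y => [|a IH] J x y cJ ns dep.
  have [|[k tk]] := classification1 b2 cJ ns dep; first by left.
  by right; exists k.
suff [|[k [tk xk]]] : type0 J x y \/ exists k, typek J a.+2 x y k /\ x k = y k.
- by left.
- by right; exists k.
apply: (gluing (b := b)) => //; first by rewrite cJ; lia.
move=> p pJ; set C := cokermx (x p).
have modP u : u *m C = 0 -> modx x p u by move/mul_cokermx_eq0.
have cJp : #|J :\ p| = (a.+1 + b).+1.
  by move: cJ; rewrite (cardsD1 p J) pJ; lia.
have [|[k [[kJ xE yE] _]]] :=
  IH _ _ _ cJp (nonsingular_link pJ ns) (dependent_link pJ ns dep).
  move=> [xE yE]; left; split; last by apply: modP; rewrite mulmx_suml.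
  move=> i iJ ip; apply: modP; rewrite mulmxDl xE ?addvv //.
  by rewrite !inE ip.
right; exists k; move: kJ; rewrite !inE => /andP[kp kJ]; split=> //.
  move=> i iJ ip ik; apply: modP; rewrite !mulmxDl xE ?inE ?ip //.
  by rewrite -addrA addvv.
by apply: modP; rewrite mulmxDl mulmx_suml yE -!scaler_nat scalemxAl addvv.
Qed.

End Classification.

(** * Normal forms *)

Section NormalForms.
Variables (n a b : nat).
Hypotheses (nab : n = (a + b)%N) (a1 : (0 < a)%N) (b2 : (2 <= b)%N).
Implicit Types (w x y : 'I_n.+1 -> 'rV['F_2]_n) (S T U Z : {set 'I_n.+1}).

(** An arbitrary index different from k, which absorbs a parity correction in
[normal_y]. *)
Definition other (k : 'I_n.+1) : 'I_n.+1 := if k == ord0 then ord_max else ord0.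

Lemma other_neq k : other k != k.
Proof.
rewrite /other; have [->|] := eqVneq k ord0; last by rewrite eq_sym.
by rewrite -val_eqE /=; lia.
Qed.

(** [normal_x e w] and [normal_y e w] parametrise the configurations of one type
by the families w of total sum 0.  The index None stands for x = y, and
Some (k, U) for the type with centre k in which x k exceeds y k by the sum of
the y j for j in U.  The term w k *+ a is added to a single y i so that the sum
of all the y i becomes w k *+ a. *)
Definition normal_y (e : option ('I_n.+1 * {set 'I_n.+1})) w i :=
  if e is Some (k, _) then
    if i == k then w k else w i + w k *+ (a * (i == other k))
  else w i.

Definition normal_x (e : option ('I_n.+1 * {set 'I_n.+1})) w i :=
  if e is Some (k, U) then
    normal_y e w i + (if i == k then \sum_(j in U) normal_y e w j else w k)
  else w i.

Arguments normal_y : simpl never.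
Arguments normal_x : simpl never.

(** The vectors y j with j outside k and [other k] form a basis of the
hyperplane in which x k - y k varies, so each such vector comes from exactly one
U. *)
Definition indices : {set option ('I_n.+1 * {set 'I_n.+1})} :=
  [set e : option ('I_n.+1 * {set 'I_n.+1}) | if e is Some (k, U) then
     (U \subset ~: [set k; other k]) && ((2 <= a)%N ==> (U == set0)) else true].

(** No proper nonempty subfamily has sum 0, as for the circuits of a binary
matroid. *)
Definition circuit w := forall S, \sum_(i in S) w i = 0 -> S = set0 \/ S = setT.

Lemma circuit_pivot w k Z N : circuit w -> k \notin Z ->
  \sum_(i in Z) w i + w k *+ N = 0 ->
  (Z = set0 /\ ~~ odd N) \/ (Z = ~: [set k] /\ odd N).
Proof.
move=> cw kZ; rewrite mulrn_odd; case: odd; rewrite ?mulr1n ?mulr0n ?addr0 => e.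
  have [|/setP/(_ k)|ZT] := cw (k |: Z); first by rewrite big_setU1 //= addrC.
    by rewrite !inE eqxx.
  right; split=> //; apply/setP=> i; rewrite !inE; have := in_setT i.
  by rewrite -ZT !inE; case: eqVneq => [->|//]; rewrite (negbTE kZ).
have [->|ZT] := cw Z e; first by left.
by rewrite ZT inE in kZ.
Qed.

Lemma sum_setU S T w : [disjoint S & T] ->
  \sum_(i in S) w i + \sum_(i in T) w i = \sum_(i in S :|: T) w i.
Proof. by move=> ST; rewrite -bigU //; apply: eq_bigl => i; rewrite !inE. Qed.

Lemma sum_delta S k : (\sum_(i in S) (i == k) = (k \in S))%N.
Proof.
case kS: (k \in S); last first.
  by rewrite big1 // => i iS; case: eqVneq => // ik; rewrite ik kS in iS.
rewrite (big_setD1 k kS) /= eqxx big1 // => i; rewrite !inE => /andP[ik _].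
by rewrite (negbTE ik).
Qed.

Lemma sum_normal_y k U w S : \sum_(i in S) normal_y (Some (k, U)) w i =
  \sum_(i in S :\ k) w i + w k *+ ((k \in S) + a * (other k \in S)).
Proof.
have yE i : normal_y (Some (k, U)) w i =
    w i *+ (i != k) + w k *+ ((i == k) + a * (i == other k)).
  rewrite /normal_y; have [->|ik] := eqVneq i k.
    by rewrite mulr0n add0r eq_sym (negbTE (other_neq k)) muln0 addn0.
  by rewrite mulr1n add0n.
rewrite (eq_bigr _ (fun i _ => yE i)) big_split /=; congr (_ + _).
  rewrite big_mkcond [RHS]big_mkcond; apply: eq_bigr => i _.
  by rewrite !inE; case: (i \in S); case: (i != k).
by rewrite sumrMnr big_split /= -big_distrr /= !sum_delta.
Qed.

Lemma sum_normal_x k U w S : \sum_(i in S) normal_x (Some (k, U)) w i =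
  \sum_(i in S) normal_y (Some (k, U)) w i + w k *+ #|S :\ k|
  + (\sum_(i in U) normal_y (Some (k, U)) w i) *+ (k \in S).
Proof.
rewrite big_split /= -addrA; congr (_ + _).
have off : {in S :\ k, (fun i => if i == k then
    \sum_(j in U) normal_y (Some (k, U)) w j else w k) =1 fun=> w k}.
  by move=> i; rewrite !inE => /andP[/negbTE->].
case kS: (k \in S).
  by rewrite (big_setD1 k kS) /= eqxx (eq_bigr _ off) sumr_const addrC mulr1n.
have SkE : S :\ k = S by apply/setDidPl; rewrite disjoint_sym disjoints1 kS.
by rewrite mulr0n addr0 -{1}SkE (eq_bigr _ off) sumr_const.
Qed.

(** After expansion a vanishing sum becomes w(Z) + N w_k = 0 with k not in Z, so
Z is empty with N even, or consists of all indices but k with N odd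
([circuit_pivot]).  If k is not in S or U is empty, the first case forces S and T
to be empty, and the second forces |S| = a and |T| = b, so that N = a + a is
even.  Otherwise a = 1 and S = [set k], and N is odd or even according to whether
[other k] is outside or inside Z, the opposite of what either case requires. *)
Lemma normal_nonsingular e w : e \in indices -> circuit w ->
  nonsingular setT a b (normal_x e w) (normal_y e w).
Proof.
move=> He cw S T _ _ ST Sa Tb.
have cST : #|S :|: T| = (#|S| + #|T|)%N by apply/eqP; rewrite (leq_card_setU S T).2.
have cC k : #|~: [set k : 'I_n.+1]| = n by rewrite cardsC1 card_ord.
case: e He => [[k U]|]; rewrite inE; last first.
  rewrite sum_setU // => _ /cw[/eqP|ST_T].
    by rewrite setU_eq0 => /andP[/eqP-> /eqP->].
  by move: cST; rewrite ST_T cardsT card_ord; lia.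
move=> /andP[UE /implyP U0]; rewrite sum_normal_x.
have yS := sum_normal_y k U w.
have [/andP[kS U_n0]|] := boolP ((k \in S) && (U != set0)).
  have aE : a = 1%N.
    by apply/eqP; rewrite eqn_leq a1 andbT leqNgt; apply: contra U_n0 => /U0.
  have SE : S = [set k].
    by apply/eqP; rewrite eq_sym eqEcard sub1set kS cards1 -aE.
  have kT : k \notin T by move: ST; rewrite SE disjoints1.
  have [kU oU] : k \notin U /\ other k \notin U.
    by split; apply/negP=> h; move/subsetP: UE => /(_ _ h);
      rewrite !inE eqxx ?orbT.
  rewrite SE setDv cards0 big_set1 {1}/normal_y inE eqxx mulr1n addr0.
  rewrite -addrA -sum_symdiff addrC yS [(other k \in _)]in_symdiff.
  set Z := symdiff U T.
  have kZ : k \notin Z by rewrite in_symdiff (negbTE kU) (negbTE kT).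
  rewrite (negbTE kZ) add0n aE mul1n -addrA -mulrSr => H.
  have oZ : (other k \in Z :\ k) = (other k \in U) (+) (other k \in T).
    by rewrite -in_symdiff inE in_set1 other_neq.
  have [|[Z0]|[ZC]] := circuit_pivot cw _ H; first by rewrite !inE eqxx.
    by rewrite -oZ Z0 inE.
  by rewrite -oZ ZC !inE other_neq.
rewrite negb_and negbK => kSU.
have -> : (\sum_(i in U) normal_y (Some (k, U)) w i) *+ (k \in S) = 0.
  case/orP: kSU => [/negbTE->|/eqP->]; first by rewrite mulr0n.
  by rewrite big_set0 mul0rn.
rewrite addr0 addrAC sum_setU // yS -addrA -mulrnDr.
set R := S :|: T in cST *; have SR : S \subset R by apply: subsetUl.
move=> /circuit_pivot-/(_ cw)[|[R0]|[RC]]; first by rewrite !inE eqxx.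
  have Rk : R \subset [set k] by rewrite -setD_eq0 R0.
  have /eqP-> : S :\ k == set0 by rewrite setD_eq0 (subset_trans SR).
  have oR : other k \notin R.
    by apply/negP=> /(subsetP Rk); rewrite inE (negbTE (other_neq k)).
  rewrite (negbTE oR) muln0 addn0 cards0 addn0 oddb => kR.
  suff /eqP : R == set0 by move/eqP; rewrite setU_eq0 => /andP[/eqP-> /eqP->].
  by move: Rk; rewrite subset1 => /orP[/eqP E|//]; rewrite E inE eqxx in kR.
have cR : (n <= #|R :\ k|)%N by rewrite RC cC.
have kR : k \notin R.
  apply/negP=> kR; move: cST; rewrite (cardsD1 k R) kR; lia.
have RE : R :\ k = R by apply/setDidPl; rewrite disjoint_sym disjoints1.
have kS : k \notin S by apply: contra kR; apply: (subsetP SR).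
have -> : S :\ k = S by apply/setDidPl; rewrite disjoint_sym disjoints1.
rewrite RE in cR; have -> : #|S| = a by lia.
have oR : other k \in R by rewrite -RE RC !inE other_neq.
by rewrite (negbTE kR) oR muln1 add0n addnn odd_double.
Qed.

Lemma card_pairC k : #|~: [set k; other k]| = n.-1.
Proof. by rewrite cardsCs setCK card_ord cards2 eq_sym other_neq; lia. Qed.

(** The differences x i - y i, which are invariants of the configuration,
determine e. *)
Lemma normal_gap k U w i : normal_x (Some (k, U)) w i +
    normal_y (Some (k, U)) w i =
  if i == k then \sum_(j in U) normal_y (Some (k, U)) w j
  else normal_y (Some (k, U)) w k.
Proof. by rewrite {1}/normal_x addrAC addvv add0r /normal_y eqxx. Qed.

Lemma normal_inj e e' w w' : e \in indices -> e' \in indices ->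
  nonsingular setT a b (normal_x e w) (normal_y e w) ->
  normal_x e w =1 normal_x e' w' -> normal_y e w =1 normal_y e' w' -> e = e'.
Proof.
have None_Some k U w1 w2 :
    nonsingular setT a b (normal_x (Some (k, U)) w1) (normal_y (Some (k, U)) w1) ->
    normal_x (Some (k, U)) w1 =1 w2 -> normal_y (Some (k, U)) w1 =1 w2 -> False.
  move=> ns ex ey; have := normal_gap k U w1 (other k).
  rewrite ex ey addvv (negbTE (other_neq k)) => /esym/eqP.
  by rewrite (negbTE (y_neq0 b2 ns (in_setT k))).
case: e e' => [[k U]|] [[k' U']|] He He' ns ex ey //.
- have gap i := normal_gap k U w i.
  have gap' i : normal_x (Some (k, U)) w i + normal_y (Some (k, U)) w i =
      if i == k' then \sum_(j in U') normal_y (Some (k, U)) w j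
      else normal_y (Some (k, U)) w k'.
    by rewrite ex ey normal_gap ey; under eq_bigr do rewrite -ey.
  have [kk'|kk'] := eqVneq k k'; last first.
    have [|i _] := @fresh _ setT [:: k; k']; first by rewrite cardsT card_ord /=; lia.
    rewrite !inE negb_or => /andP[ik ik'].
    have := gap' i; rewrite gap (negbTE ik) (negbTE ik') => e.
    suff : [::] ++ [:: k; k'] = [::] by [].
    apply: (nonsingular_seq ns) => //=; first by rewrite inE kk'.
    by rewrite big_nil big_cons big_seq1 add0r e addvv.
  rewrite -{k'}kk' in He' ex ey gap' *; congr Some; congr pair.
  move: He He'; rewrite !inE => /andP[UE /implyP U0] /andP[UE' /implyP U0'].
  have [a2|a_1] := ltnP 1 a; first by rewrite (eqP (U0 a2)) (eqP (U0' a2)).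
  apply: symdiff_eq0; have [||||||_ //] := ns set0 (symdiff U U').
  - exact: sub0set.
  - exact: subsetT.
  - by rewrite -setI_eq0 set0I.
  - by rewrite cards0.
  - have sub : symdiff U U' \subset ~: [set k; other k].
      by rewrite subUset !(subset_trans (subsetDl _ _)).
    by rewrite (leq_trans (subset_leq_card sub)) // card_pairC; lia.
  by rewrite big_set0 add0r sum_symdiff; have := gap' k; rewrite gap eqxx => ->;
     rewrite addvv.
- by case: (None_Some k U w w').
have ns' : nonsingular setT a b (normal_x (Some (k', U')) w')
    (normal_y (Some (k', U')) w').
  move=> S T SJ TJ ST Sa Tb; under eq_bigr do rewrite -ex.
  by under [X in _ + X]eq_bigr do rewrite -ey; exact: ns.
by case: (None_Some k' U' w' w ns') => i; rewrite -?ex -?ey.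
Qed.

(** For a = 1 it remains to express x k.  The m vectors x k and y i with
i != other k are dependent; a relation without x k is excluded since the only
one between the y i has all terms but y k, in particular that of [other k], and
a relation with x k but without y k would be too short. *)
Lemma normal_complete x y : nonsingular setT a b x y -> dependent setT x y ->
  exists2 e, e \in indices & exists w, [/\ \sum_i w i = 0,
    x =1 normal_x e w & y =1 normal_y e w].
Proof.
have sumT z : \sum_(i in [set: 'I_n.+1]) z i = \sum_i z i :> 'rV['F_2]_n.
  by apply: eq_bigl => i; rewrite inE.
move=> ns dep; have [|xy|[k [[_ xE yE] xk]]] := classification a1 b2 _ ns dep.
- by rewrite cardsT card_ord nab.
- case: xy => xE yE; exists None; first by rewrite inE.
  exists y; split=> [|i|i //]; last by rewrite xE ?inE.
  by rewrite -sumT.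
have yE' : \sum_i y i = y k *+ a by rewrite -sumT.
pose w i := if i == k then y k else y i + y k *+ (a * (i == other k)).
have wk : w k = y k by rewrite /w eqxx.
have yN U i : normal_y (Some (k, U)) w i = y i.
  rewrite /normal_y wk; have [->//|ik] := eqVneq i k.
  by rewrite /w (negbTE ik) addvK.
have w0 : \sum_i w i = 0.
  apply: etrans (addvv (y k *+ a)); rewrite -{1}yE'.
  rewrite (bigD1 k) //= [in RHS](bigD1 k) //= wk.
  rewrite -addrA; congr (_ + _).
  transitivity (\sum_(i | i != k) (y i + y k *+ (a * (i == other k)))).
    by apply: eq_bigr => i /negbTE ik; rewrite /w ik.
  rewrite big_split /= sumrMnr -big_distrr /=; congr (_ + _ *+ _).
  rewrite (bigD1 (other k)) ?other_neq //=.
  by rewrite eqxx big1 ?muln1 // => i /andP[_ /negbTE->].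
suff [U HU xkE] : exists2 U, Some (k, U) \in indices &
    x k = y k + \sum_(i in U) y i.
  exists (Some (k, U)) => //; exists w; split=> // i; last by rewrite yN.
  rewrite /normal_x yN; have [->|ik] := eqVneq i k; last by rewrite wk xE ?inE.
  by rewrite xkE; under [in RHS]eq_bigr do rewrite yN.
have inU U : other k \notin U -> k \notin U -> ((2 <= a)%N -> U = set0) ->
    Some (k, U) \in indices.
  move=> oU kU U0; rewrite inE; apply/andP; split.
    by rewrite -disjoints_subset disjoint_sym -setI_eq0 setIUl setU_eq0 !setI_eq0
      !disjoints1 kU.
  by apply/implyP=> /U0->.
have [a2|a_1] := ltnP 1 a.
  exists set0; last by rewrite big_set0 addr0 xk.
  by apply: inU; rewrite ?inE.
have aE : a = 1%N by lia.
have yE1 : \sum_i y i = y k by rewrite yE' aE.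
have ySk : \sum_(i in ~: [set k]) y i = 0.
  apply: (@addrI _ (y k)); rewrite addr0 -[RHS]yE1 [RHS](bigD1 k) //=.
  by congr (_ + _); apply: eq_bigl => i; rewrite !inE.
have small Z : \sum_(i in Z) y i = 0 -> (#|Z| <= b)%N -> Z = set0.
  move=> yZ Zb; have [||||||_ //] := ns set0 Z; rewrite ?sub0set ?subsetT ?cards0 //.
    by rewrite -setI_eq0 set0I.
  by rewrite big_set0 add0r.
have small1 Z : x k + \sum_(i in Z) y i = 0 -> (#|Z| <= b)%N -> k \in Z.
  move=> yZ Zb; apply/negPn/negP=> kZ.
  have [||||||/setP/(_ k)] := ns [set k] Z; rewrite ?subsetT ?cards1 //.
  - by rewrite disjoints1.
  - by rewrite big_set1.
  by rewrite !inE eqxx.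
(* The slot of [other k] is reused for x k. *)
pose z i := if i == other k then x k else y i.
have [|Z [_ Z0 zZ]] := exists_zero_sum (J := setT) z.
  by rewrite cardsT card_ord.
have zE Z1 : other k \notin Z1 -> \sum_(i in Z1) z i = \sum_(i in Z1) y i.
  move=> oZ1; apply: eq_bigr => i; rewrite /z; case: eqVneq => // ->.
  by rewrite (negbTE oZ1).
have [oZ|oZ] := boolP (other k \in Z); last first.
  rewrite zE // in zZ; have [/(small Z zZ) E|cZ] := leqP #|Z| b.
    by rewrite E eqxx in Z0.
  have ZE : Z = ~: [set other k].
    apply/eqP; rewrite eqEcard cardsC1 card_ord (_ : (n <= #|Z|)%N) ?andbT; last by lia.
    by rewrite -disjoints_subset disjoint_sym disjoints1.
  have E : symdiff Z (~: [set k]) = [set k; other k].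
    apply/setP=> i; rewrite in_symdiff ZE !inE; have [->|_] := eqVneq i k.
      by rewrite eq_sym other_neq.
    by rewrite addbT negbK.
  have := small (symdiff Z (~: [set k])); rewrite sum_symdiff zZ ySk addr0 E.
  rewrite cards2 => /(_ erefl); rewrite (leq_trans _ b2) ?ltnS ?leq_b1 //.
  by move=> /(_ isT)/setP/(_ k); rewrite !inE eqxx.
move: zZ; rewrite (big_setD1 _ oZ) /= zE ?inE ?eqxx // {1}/z eqxx => zZ.
have [kZ|kZ] := boolP (k \in Z :\ other k); last first.
  have sub : Z :\ other k \subset ~: [set k; other k].
    apply/subsetP=> i iZ; rewrite !inE negb_or.
    by move: (iZ); rewrite !inE => /andP[-> _]; rewrite andbT;
       apply: contraNneq kZ => e; rewrite -{1}e.
  case/negP: kZ; apply: small1 => //.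
  by rewrite (leq_trans (subset_leq_card sub)) // card_pairC; lia.
exists (Z :\ other k :\ k).
  by apply: inU; rewrite ?aE // !inE eqxx ?andbF.
by apply: addv_eq0; apply: etrans zZ; rewrite [in RHS](big_setD1 k kZ).
Qed.

End NormalForms.

(** * Orbits under the linear group *)

Section Counting.
Variables (n a b : nat).
Hypothesis nab : n = (a + b)%N.
Implicit Types (x y : 'I_n.+1 -> 'rV['F_2]_n) (T : finType).

(** E indexes exactly one configuration in each orbit of the linear group. *)
Definition transversal T (E : {set T}) (X Y : T -> 'I_n.+1 -> 'rV['F_2]_n) :=
  [/\ forall e, e \in E -> nonsingular setT a b (X e) (Y e),
      forall x y, nonsingular setT a b x y -> exists2 e, e \in E &
        exists2 P, P \in unitmx & forall i, x i = X e i *m P /\ y i = Y e i *m P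
    & forall e e' P, e \in E -> e' \in E -> P \in unitmx ->
        (forall i, X e' i = X e i *m P /\ Y e' i = Y e i *m P) -> e = e'].

Lemma exists_subset (I : finType) (J : {set I}) k : (k <= #|J|)%N ->
  exists2 Q : {set I}, Q \subset J & #|Q| = k.
Proof.
move=> kJ; exists [set i in take k (enum J)].
  by apply/subsetP=> i; rewrite inE => /mem_take; rewrite mem_enum.
by rewrite cardsE (card_uniqP _) ?take_uniq ?enum_uniq // size_takel -?cardE.
Qed.

(** If P were singular, the configuration would live in the row space of P,
of dimension less than n, and the n vectors of a facet would be dependent. *)
Lemma nonsingular_unitmx x y (P : 'M_n) :
  nonsingular setT a b (fun i => x i *m P) (fun i => y i *m P) -> P \in unitmx.
Proof.
move=> ns; rewrite -row_free_unit /row_free eqn_leq rank_leq_row leqNgt.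
apply/negP=> rP; pose J := ~: [set ord0 : 'I_n.+1].
have cJ : #|J| = n by rewrite cardsC1 card_ord.
have [|Q QJ cQ] := @exists_subset _ J a; first by rewrite cJ nab leq_addr.
have [|S [T [SQ TQ ne e]]] := @dependent_of_card (\rank P) _ J
  (fun i => x i *m col_base P) (fun i => y i *m col_base P) _ Q QJ.
  by rewrite cJ.
have [||||||S0 T0] := ns S T; last by rewrite S0 T0 eqxx in ne.
- exact: subsetT.
- exact: subsetT.
- rewrite disjoint_sym disjoints_subset (subset_trans TQ) //.
  by rewrite setDE (subset_trans (subsetIr _ _)) // setCS.
- by rewrite -cQ subset_leq_card.
- rewrite (leq_trans (subset_leq_card TQ)) // cardsD (setIidPr QJ) cJ cQ.
  by rewrite nab addKn.
by rewrite sum_quotient -(mulmx_base P) mulmxA -sum_quotient e mul0mx.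
Qed.

Definition simplex_circuit (i : 'I_n.+1) : 'rV['F_2]_n :=
  if unlift ord0 i is Some j then delta_mx 0 j else const_mx 1.

Lemma simplex_circuit0 : simplex_circuit ord0 = const_mx 1.
Proof. by rewrite /simplex_circuit unlift_none. Qed.

Lemma simplex_circuit_lift j : simplex_circuit (lift ord0 j) = delta_mx 0 j.
Proof. by rewrite /simplex_circuit liftK. Qed.

Lemma simplex_circuitP : circuit simplex_circuit.
Proof.
move=> S /rowP S0.
have H j : (lift ord0 j \in S) = (ord0 \in S).
  have := S0 j; rewrite sum_mem big_ord_recl simplex_circuit0 !mxE summxE.
  rewrite (bigD1 j) //= big1 => [|i ij]; last first.
    by rewrite simplex_circuit_lift mulmxnE mxE eqxx eq_sym (negbTE ij) mul0rn.
  rewrite simplex_circuit_lift !mulmxnE !mxE !eqxx addr0.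
  by case: (ord0 \in S); case: (lift _ _ \in S).
have [S1|S1] := boolP (ord0 \in S); [right|left]; apply/setP=> i; rewrite !inE;
  by have [j ->|->] := unliftP ord0 i; rewrite ?H ?S1 // (negbTE S1).
Qed.

Lemma simplex_circuit_universal w : \sum_i w i = 0 ->
  exists P : 'M_n, forall i, w i = simplex_circuit i *m P.
Proof.
move=> w0; exists (\matrix_j w (lift ord0 j)) => i.
have [j ->|->] := unliftP ord0 i; first by rewrite simplex_circuit_lift -rowE rowK.
rewrite simplex_circuit0; apply: addv_eq0; apply: etrans w0.
rewrite big_ord_recl; congr (_ + _); apply/rowP=> k.
by rewrite !mxE summxE; apply: eq_bigr => j _; rewrite !mxE mul1r.
Qed.

Lemma normal_y_mulmx e w (P : 'M_n) i :
  normal_y a e w i *m P = normal_y a e (fun j => w j *m P) i.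
Proof.
case: e => [[k U]|] //; rewrite /normal_y; case: eqP => // _.
by rewrite mulmxDl -!scaler_nat scalemxAl.
Qed.

Lemma normal_x_mulmx e w (P : 'M_n) i :
  normal_x a e w i *m P = normal_x a e (fun j => w j *m P) i.
Proof.
case: e => [[k U]|] //; rewrite /normal_x mulmxDl normal_y_mulmx; congr (_ + _).
case: eqP => // _; rewrite mulmx_suml.
by apply: eq_bigr => j _; rewrite normal_y_mulmx.
Qed.

Lemma normal_transversal : (0 < a)%N -> (2 <= b)%N ->
  transversal (indices n a) (fun e => normal_x a e simplex_circuit)
    (fun e => normal_y a e simplex_circuit).
Proof.
move=> a1 b2; split.
- by move=> e He; apply: normal_nonsingular => //; apply: simplex_circuitP.
- move=> x y ns.
  have dep : dependent setT x y.
    by apply: dependent_of_card; rewrite cardsT card_ord.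
  have [e He [w [w0 xE yE]]] := normal_complete nab a1 b2 ns dep; exists e => //.
  have [P wP] := simplex_circuit_universal w0.
  have wE : w = fun i => simplex_circuit i *m P by apply/funext.
  have xE' i : x i = normal_x a e simplex_circuit i *m P.
    by rewrite xE normal_x_mulmx wE.
  have yE' i : y i = normal_y a e simplex_circuit i *m P.
    by rewrite yE normal_y_mulmx wE.
  exists P => [|i]; last by rewrite -xE' -yE'.
  apply: (@nonsingular_unitmx (normal_x a e simplex_circuit)
    (normal_y a e simplex_circuit)).
  have <- : x = fun i => normal_x a e simplex_circuit i *m P by apply/funext.
  by have <- : y = fun i => normal_y a e simplex_circuit i *m P by apply/funext.
move=> e e' P He He' uP PE; apply/esym.
apply: (@normal_inj _ _ _ nab a1 b2 e' e simplex_circuit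
  (fun i => simplex_circuit i *m P)) => // [|i|i].
- by apply: normal_nonsingular => //; apply: simplex_circuitP.
- by rewrite (PE i).1 normal_x_mulmx.
- by rewrite (PE i).2 normal_y_mulmx.
Qed.

Lemma card_indices : (0 < a)%N -> (2 <= b)%N ->
  #|indices n a| = (1 + n.+1 * (if a == 1 then 2 ^ n.-1 else 1))%N.
Proof.
move=> a1 b2; pose B k := [set U : {set 'I_n.+1} |
  (U \subset ~: [set k; other k]) && ((2 <= a)%N ==> (U == set0))].
have cB k : #|B k| = (if a == 1 then 2 ^ n.-1 else 1)%N.
  have [a_1|a2] := eqVneq a 1%N.
    rewrite -(card_pairC nab a1 b2 k) -card_powerset; apply: eq_card => U.
    by rewrite !inE a_1 andbT.
  rewrite -(cards1 (set0 : {set 'I_n.+1})); apply: eq_card => U; rewrite !inE.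
  by rewrite ltn_neqAle eq_sym a2 a1 /=; case: eqP => [->|]; rewrite ?sub0set ?andbF.
have -> : indices n a = None |: Some @: [set p | p.2 \in B p.1].
  apply/setP=> -[[k U]|]; last by rewrite !inE.
  by rewrite !inE /= mem_imset ?inE //; exact: Some_inj.
rewrite cardsU1 card_imset; last exact: Some_inj.
have -> : (None \notin Some @: [set p | p.2 \in B p.1]) = true.
  by apply/imsetP=> -[].
congr (_ + _)%N; rewrite -sum1dep_card -(pair_big_dep xpredT (fun k U => U \in B k)
  (fun _ _ => 1%N)) /=.
under eq_bigr do rewrite sum1_card cB.
by rewrite sum_nat_const card_ord.
Qed.

End Counting.

Lemma transversal_swap n a b (T : finType) (E : {set T})
    (X Y : T -> 'I_n.+1 -> 'rV['F_2]_n) :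
  transversal a b E X Y -> transversal b a E Y X.
Proof.
case=> ns ex inj; split.
- by move=> e /ns/nonsingular_swap.
- move=> x y /nonsingular_swap/ex[e He [P uP PE]].
  by exists e => //; exists P => // i; have [] := PE i.
- move=> e e' P He He' uP PE; apply: (inj e e' P) => // i.
  by have [] := PE i.
Qed.

(** * From characteristic matrices to configurations *)

Lemma free_subset_sums n (S : finType) (f : S -> 'cV['F_2]_n) (sigma : {set S}) :
  reflect (forall U : {set S}, U \subset sigma -> \sum_(s in U) f s = 0 ->
    U = set0) (free [seq f s | s <- enum sigma]).
Proof.
set e := in_tuple (enum sigma).
have e_inj : injective (tnth e) by apply/tuple_uniqP/enum_uniq.
have sumE (k : 'I_(size (enum sigma)) -> 'F_2) :
    \sum_i k i *: (map_tuple f e)`_i =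
    \sum_(s in [set tnth e i | i in [pred i | k i != 0]]) f s.
  rewrite big_imset /=; last by move=> i j _ _; apply: e_inj.
  rewrite [RHS]big_mkcond; apply: eq_bigr => i _.
  rewrite -(tnth_nth 0 (map_tuple f e)) tnth_map inE; case: (k i) => -[|[|//]] ki.
    by rewrite (_ : Ordinal ki = 0) ?scale0r ?eqxx //; apply: val_inj.
  by rewrite (_ : Ordinal ki = 1) ?scale1r ?oner_eq0 //; apply: val_inj.
rewrite -[[seq f s | s <- enum sigma]]/(tval (map_tuple f e)).
apply: (iffP (@freeP _ _ _ (map_tuple f e))) => [fr U Us U0|H k].
  pose k i : 'F_2 := (tnth e i \in U)%:R.
  have kE : [set tnth e i | i in [pred i | k i != 0]] = U.
    apply/setP=> s; apply/imsetP/idP => [[i]|sU].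
      by rewrite inE /k; case: (_ \in U) / idP => // ? _ ->.
    have /tnthP[i si] : s \in e by rewrite mem_enum (subsetP Us).
    by exists i; rewrite // inE /k -si sU oner_eq0.
  have k0 := fr k; rewrite sumE kE in k0.
  apply/setP=> s; rewrite inE; apply/negP=> sU.
  have /tnthP[i si] : s \in e by rewrite mem_enum (subsetP Us).
  by have /eqP := k0 U0 i; rewrite /k -si sU oner_eq0.
rewrite sumE => /H E i; apply/eqP/negPn/negP=> ki.
have /setP/(_ (tnth e i)) : [set tnth e i | i in [pred i | k i != 0]] = set0.
  apply: E; apply/subsetP=> _ /imsetP[j _ ->].
  by rewrite -mem_enum mem_tnth.
by rewrite inE imset_f.
Qed.

Lemma col_mulmx (R : comNzRingType) p q s j (A : 'M[R]_(p, q)) (B : 'M_(q, s)) :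
  col j (A *m B) = A *m col j B.
Proof. by rewrite !colE mulmxA. Qed.

Section Matrices.
Variables (n : nat) (m : nat).
Implicit Types (x y : 'I_m -> 'rV['F_2]_n) (L : 'M['F_2]_(n, #|{: 'I_m + 'I_m}|)).

Definition plain_col L i : 'rV_n := (col (enum_rank (inl i : 'I_m + 'I_m)) L)^T.
Definition barred_col L i : 'rV_n := (col (enum_rank (inr i : 'I_m + 'I_m)) L)^T.

Definition col_matrix x y : 'M['F_2]_(n, #|{: 'I_m + 'I_m}|) :=
  \matrix_(i, s) match enum_val s with inl j => x j 0 i | inr j => y j 0 i end.

Lemma plain_col_matrix x y : plain_col (col_matrix x y) = x.
Proof. by apply/funext=> i; apply/rowP=> j; rewrite !mxE enum_rankK. Qed.

Lemma barred_col_matrix x y : barred_col (col_matrix x y) = y.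
Proof. by apply/funext=> i; apply/rowP=> j; rewrite !mxE enum_rankK. Qed.

(** Columns are treated as row vectors, so P acts on them by P^T on the
right. *)
Lemma col_matrixP L x y (P : 'M_n) : L = P *m col_matrix x y <->
  (forall i, plain_col L i = x i *m P^T /\ barred_col L i = y i *m P^T).
Proof.
split=> [-> i|H].
  rewrite /plain_col /barred_col !col_mulmx !trmx_mul.
  by rewrite -/(plain_col _ i) -/(barred_col _ i) plain_col_matrix barred_col_matrix.
apply/matrixP=> i s; rewrite -(enum_valK s); case: (enum_val s) => j.
  have /rowP/(_ i) := (H j).1; rewrite -{1}(plain_col_matrix x y) -trmx_mul.
  by rewrite -col_mulmx !mxE.
have /rowP/(_ i) := (H j).2; rewrite -{1}(barred_col_matrix x y) -trmx_mul.
by rewrite -col_mulmx !mxE.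
Qed.

Lemma mem_bier (K : {set {set 'I_m}}) sigma tau : sigma \in K ->
  ~: tau \notin K -> [disjoint sigma & tau] ->
  (inl @: sigma) :|: (inr @: tau) \in bier K.
Proof.
move=> sK tK st; apply/imset2P; exists sigma tau => //.
by rewrite !inE tK.
Qed.

Lemma sum_cols L (U : {set 'I_m + 'I_m}) :
  \sum_(s in U) col (enum_rank s) L =
  (\sum_(i in [set i | inl i \in U]) plain_col L i +
   \sum_(i in [set i | inr i \in U]) barred_col L i)^T.
Proof.
rewrite big_sumType /= linearD !linear_sum /=.
by congr (_ + _); apply: eq_big => i; rewrite ?inE // trmxK.
Qed.

(** Simplices of the Bier sphere are unions of a plain and a barred part, and
the subsets of a simplex have the same shape; [nonsingular] ranges over all
these subsets at once. *)
Lemma characteristicP L r : (r.+2 <= m)%N ->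
  reflect (nonsingular setT r.+1 (m - r.+2) (plain_col L) (barred_col L))
    (characteristic (bier (skeleton m r)) L).
Proof.
move=> rm.
have dualE (tau : {set 'I_m}) :
    (~: tau \notin skeleton m r) = (#|tau| <= m - r.+2)%N.
  rewrite inE -ltnNge cardsCs setCK card_ord.
  by have := max_card tau; rewrite card_ord; lia.
apply: (iffP forall_inP) => [H S T _ _ ST Sr Tr e|ns _ /imset2P[S T SK TK ->]].
  have STK : inl @: S :|: inr @: T \in bier (skeleton m r).
    by apply: mem_bier; rewrite ?dualE ?inE.
  have U0 := free_subset_sums _ _ (H _ STK) _ (subxx _).
  move: U0; rewrite sum_cols.
  have -> : [set i | inl i \in inl @: S :|: [set inr x | x in T]] = S.
    apply/setP=> i; rewrite !inE mem_imset ?orbF; last by move=> ? ? [].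
    by case: imsetP => [[]//|]; rewrite orbF.
  have -> : [set i | inr i \in inl @: S :|: [set inr x | x in T]] = T.
    apply/setP=> i; rewrite !inE (mem_imset T); last by move=> ? ? [].
    by case: imsetP => [[]//|].
  rewrite e trmx0 => /(_ erefl)/eqP.
  by rewrite setU_eq0 !imset_eq0 => /andP[/eqP-> /eqP->].
apply/free_subset_sums=> U UST; rewrite sum_cols => /(congr1 trmx).
rewrite trmxK trmx0 => e.
have memU s : s \in U -> s \in inl @: S :|: inr @: T by apply/subsetP.
have lS : [set i | inl i \in U] \subset S.
  apply/subsetP=> i; rewrite inE => /memU; rewrite inE => /orP[] /imsetP[j] //.
  by move=> jS [->].
have rT : [set i | inr i \in U] \subset T.
  apply/subsetP=> i; rewrite inE => /memU; rewrite inE => /orP[] /imsetP[j] //.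
  by move=> jT [->].
move: TK; rewrite inE => /andP[]; rewrite inE dualE => Tb ST.
rewrite inE in SK.
have [||||||lS0 rT0] := ns [set i | inl i \in U] [set i | inr i \in U].
- exact: subsetT.
- exact: subsetT.
- exact: disjointWl lS (disjointWr rT ST).
- exact: leq_trans (subset_leq_card lS) SK.
- exact: leq_trans (subset_leq_card rT) Tb.
- exact: e.
apply/setP=> -[i|i]; rewrite inE.
  by move/setP/(_ i): lS0; rewrite !inE.
by move/setP/(_ i): rT0; rewrite !inE.
Qed.

End Matrices.

Lemma card_DJ_classes n r (T : finType) (E : {set T})
    (X Y : T -> 'I_n.+1 -> 'rV['F_2]_n) : (r.+2 <= n.+1)%N ->
  transversal r.+1 (n.+1 - r.+2) E X Y ->
  #|DJ_classes n (bier (skeleton n.+1 r))| = #|E|.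
Proof.
move=> rn [ns ex inj]; set G := bier _.
pose cls e := [set M : small_cover n G | [exists P : 'M_n,
  (P \in unitmx) && (char_matrix M == P *m col_matrix (X e) (Y e))]].
have charP e : e \in E -> characteristic G (col_matrix (X e) (Y e)).
  by move=> He; apply/characteristicP; rewrite // plain_col_matrix barred_col_matrix;
     apply: ns.
have clsE e (He : e \in E) M : (M \in cls e) = DJ_equiv (SmallCover (charP e He)) M.
  by rewrite inE.
have cls_inj : {in E &, injective cls}.
  move=> e e' He He' ee'.
  have : SmallCover (charP e' He') \in cls e by rewrite ee' clsE DJ_equiv_refl.
  rewrite inE => /existsP[P /andP[uP /eqP /= /col_matrixP H]].
  have uPT : P^T \in unitmx by rewrite unitmx_tr.
  apply: (inj e e' P^T He He' uPT) => i.
  have [H1 H2] := H i; rewrite plain_col_matrix in H1.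
  by rewrite barred_col_matrix in H2; split.
suff -> : DJ_classes n G = cls @: E by rewrite card_in_imset.
apply/setP=> C; apply/imsetP/imsetP => [[M _ ->]|[e He ->]]; last first.
  exists (SmallCover (charP e He)); rewrite ?inE //.
  by apply/setP=> M; rewrite clsE !inE.
have /characteristicP-/(_ rn)/ex[e He [P uP PE]] := char_matrixP M.
have : M \in cls e.
  rewrite inE; apply/existsP; exists P^T; rewrite unitmx_tr uP /=.
  by apply/eqP/col_matrixP=> i; rewrite trmxK.
rewrite (clsE e He) => DJM; exists e => //; apply/setP=> M'.
rewrite (clsE e He) !inE; apply/idP/idP; first exact: DJ_equiv_trans.
by apply: DJ_equiv_trans; rewrite DJ_equiv_sym.
Qed.

Theorem theorem1p1 (m r : nat) (hm : (4 <= m)%N) (hr : (r <= m - 3)%N) :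
  #|DJ_classes m.-1 (bier (skeleton m r))| =
  (if (r == 0) || (r == m - 3) then 1 + m * 2 ^ (m - 2) else 1 + m)%N.
Proof.
case: m hm hr => // n hn hr; rewrite [n.+1.-1]/=.
have nr : n = (r.+1 + (n.+1 - r.+2))%N by lia.
have [b2|b1] := leqP 2 (n.+1 - r.+2).
  rewrite (card_DJ_classes _ (normal_transversal nr isT b2)); last by lia.
  rewrite (card_indices nr isT b2) eqSS (_ : r == n.+1 - 3 = false)%N; last by lia.
  rewrite orbF (_ : n.-1 = n.+1 - 2)%N; last by lia.
  by case: eqP => // _; rewrite muln1.
(* Here r = m - 3 and b = 1: exchange the two families. *)
have rE : r = (n.+1 - 3)%N by lia.
have nr' : n = (n.+1 - r.+2 + r.+1)%N by rewrite addnC.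
have T := normal_transversal nr' _ _.
rewrite (card_DJ_classes _ (transversal_swap (T _ _))); try lia.
rewrite (card_indices nr'); try lia.
rewrite -rE eqxx orbT (_ : n.+1 - r.+2 = 1)%N; last by lia.
by rewrite eqxx (_ : n.-1 = n.+1 - 2)%N //; lia.
Qed.
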